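(* Let $\mathcal{P}_n$ denote the set of tilings of the $n\times n$ square grid by $n$-ominoes, and let $\mathfrak{b} := \exp\left(\frac{4C}{\pi}\right) = 3.2099\dots$, where $C=\sum_{k=0}^\infty \frac{(-1)^k}{(2k+1)^2}$ is Catalan's constant. Then $|\mathcal{P}_n| \lesssim (\mathfrak{b}+o(1))^{n^2}$; that is, there is a function $f:\mathbb{N}\to\mathbb{R}$ with $f(n)\to 0$ as $n\to\infty$ such that \[\limsup_{n\to\infty} \frac{|\mathcal{P}_n|}{(\mathfrak{b}+f(n))^{n^2}} < \infty.\]
   Context: An $n$-omino is a collection of $n$ unit squares of the grid that is connected via shared edges (each square shares an edge with another square of the collection, and the collection is edge-connected). A tiling of the $n\times n$ grid by $n$-ominoes is a partition of its $n^2$ unit squares into $n$ such $n$-ominoes. Equivalently, letting $G_n$ be the $n\times n$ grid graph (vertex set $\{1,\dots,n\}^2$, two vertices adjacent iff they differ by $1$ in exactly one coordinate), $\mathcal{P}_n$ is in bijection with the set of partitions of the vertex set of $G_n$ into $n$ disjoint parts, each inducing a connected subgraph with exactly $n$ vertices. *)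

(* Defs.v *)
From HB Require Import structures.
From mathcomp Require Import all_boot all_order all_algebra.
From mathcomp Require Import all_classical all_reals all_analysis.

Set Implicit Arguments.
Unset Strict Implicit.
Unset Printing Implicit Defensive.

Import Order.TTheory GRing.Theory Num.Theory.
Import numFieldNormedType.Exports.

(* The coordinates 1, ..., n are shifted to the elements 0, ..., n - 1 of 'I_n. *)
Definition cell (n : nat) : finType := ('I_n * 'I_n)%type.

Definition succ_or_pred (i j : nat) : bool := (i.+1 == j) || (j.+1 == i).

Definition grid_adj (n : nat) : rel (cell n) := fun u v =>
  ((u.1 == v.1) && succ_or_pred u.2 v.2) ||
  (succ_or_pred u.1 v.1 && (u.2 == v.2)).

Definition induced (T : finType) (e : rel T) (B : {set T}) : rel T :=
  fun u v => [&& u \in B, v \in B & e u v].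

Definition connected_in (T : finType) (e : rel T) (B : {set T}) : bool :=
  [forall u in B, forall v in B, connect (induced e B) u v].

Definition is_omino (n : nat) (B : {set cell n}) : bool :=
  (#|B| == n) && connected_in (@grid_adj n) B.

(* Tilings are counted as labelled objects, not up to symmetries of the square. *)
Definition tilings (n : nat) : {set {set {set cell n}}} :=
  [set P : {set {set cell n}} |
     [&& finset.partition P [set: cell n]%SET, #|P| == n &
         [forall B in P, is_omino B]]].

Local Open Scope ring_scope.
Local Open Scope classical_set_scope.

Definition catalan (R : realType) : R :=
  limn (series (fun k : nat => (-1) ^+ k / ((2 * k + 1)%N%:R ^+ 2) : R)).

Definition bconst (R : realType) : R := expR (4 * catalan R / pi).

(* Main.v *)
(* Choosing a rooted spanning tree in each block embeds the tilings into the
   spanning forests of the grid with n roots. Expanding by rows shows that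
   det ((4 + x) I - A), with A the adjacency matrix of the grid, dominates the sum
   of x^(number of roots) over all rooted forests, so |P_n| x^n <= det ((4 + x) I - A)
   for every x > 0.

   The path is diagonalised by Chebyshev polynomials, hence this determinant is
   prod_i U_n(4 + x - 2 cos t_i) with t_i = pi i / (n + 1), and
   U_n(z + 1/z) <= (n + 1) z^n for z >= 1. Writing s_i = sin (t_i / 2), one may take
   ln z_i = 2 (P(s_i) + eps) when x = 4 sinh^2 eps and P is a Taylor polynomial of
   arcsinh that dominates it on the positive axis. The averages of s_i^(2k+1) are
   Riemann sums of Wallis integrals, which turn the coefficients of P into those of
   Catalan's series; so (1/n^2) ln |P_n| is at most 4C/pi + o(1), as eps tends to 0
   and the degree of P tends to infinity. *)
Require Import Defs.
From HB Require Import structures.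
From mathcomp Require Import all_boot all_order all_algebra.
From mathcomp Require Import all_classical all_reals all_analysis.
From mathcomp Require Import fingroup perm mxtens zify ring lra.

Import Order.TTheory GRing.Theory Num.Theory.
Import numFieldNormedType.Exports.
Local Open Scope ring_scope.

(** * Determinants and rooted forests *)

(** Multilinearity in the rows: [f] records which summand is picked in each row. *)
Lemma det_sum_rows {R : comNzRingType} {n : nat} {K : finType}
    (w : 'I_n -> K -> R) (g : 'I_n -> K -> 'I_n -> R) :
  \det (\matrix_(i, j) \sum_k w i k * g i k j) =
  \sum_(f : {ffun 'I_n -> K})
    (\prod_i w i (f i)) * \det (\matrix_(i, j) g i (f i) j).
Proof.
rewrite /determinant.
transitivity (\sum_(s : 'S_n) \sum_(f : {ffun 'I_n -> K})
    (-1) ^+ s * \prod_i (w i (f i) * g i (f i) (s i))).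
  apply: eq_bigr => s _; rewrite -mulr_sumr; congr (_ * _).
  rewrite -(bigA_distr_bigA (fun i k => w i k * g i k (s i))).
  by apply: eq_bigr => i _; rewrite mxE.
rewrite exchange_big; apply: eq_bigr => f _ /=.
rewrite mulr_sumr; apply: eq_bigr => s _.
rewrite big_split mulrCA; congr (_ * (_ * _)).
by apply: eq_bigr => i _; rewrite mxE.
Qed.

Section Forests.
Context {T : finType}.

(* [c] sends each vertex to its parent, and each root to [None]. *)
Definition acyclic (c : T -> option T) : Prop :=
  exists h : T -> nat, forall u v, c u = Some v -> (h v < h u)%N.

Definition ancestor (c : T -> option T) : rel T :=
  connect (fun u v => c u == Some v).

Definition rooted_forest (e : rel T) (m : nat) (c : {ffun T -> option T}) : bool :=
  [&& [forall u, forall v, (c u == Some v) ==> e u v], `[< acyclic c >]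
    & #|[set u | c u == None]%SET| == m].

Definition parent_mx (R : nzRingType) {N : nat} (b : 'I_N -> T)
    (c : 'I_N -> option T) : 'M[R]_N :=
  \matrix_(i, j) ((i == j)%:R - (c i == Some (b j))%:R).

(** Ordered by height the matrix is triangular with unit diagonal; in Leibniz's formula only the
    identity permutation survives. *)
Lemma det_parent_mx_acyclic (R : comNzRingType) (N : nat) (b : 'I_N -> T)
    (c : T -> option T) :
  injective b -> acyclic c -> \det (parent_mx R b (c \o b)) = 1.
Proof.
move=> bI [h hc]; rewrite /determinant (bigD1 1%g) //= odd_perm1 mul1r.
rewrite [X in _ + X]big1 ?addr0 => [|s s1].
  rewrite big1 // => i _; rewrite !mxE perm1 eqxx /=.
  by case: eqP => [/hc|_]; rewrite ?ltnn ?subr0.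
have [i0 si0] : exists i, s i != i.
  apply/existsP; apply: contraR s1; rewrite negb_exists => /forallP s1.
  by apply/eqP/permP => i; rewrite perm1; apply/eqP; rewrite -[_ == _]negbK s1.
(* The moved point of least height is sent to a moved point, not to its parent. *)
case: (@arg_minnP _ i0 (fun i => s i != i) (h \o b)) => //= i si hi.
have ssi : s (s i) != s i by rewrite (inj_eq perm_inj).
rewrite (bigD1 i) //= !mxE eq_sym (negbTE si) sub0r.
case: eqP => [/hc|_]; last by rewrite oppr0 mul0r mulr0.
by rewrite ltnNge hi.
Qed.

(** Either every vertex leads to a root and the determinant is 1, or some vertex leads into a cycle
    and the matrix is singular. *)
Lemma det_parent_mx_ge0 (R : realFieldType) (N : nat) (b : 'I_N -> T)
    (g : T -> 'I_N) (c : {ffun 'I_N -> option T}) :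
  cancel b g -> cancel g b -> 0 <= \det (parent_mx R b c).
Proof.
move=> bK gK; pose c' := c \o g.
have -> : parent_mx R b c = parent_mx R b (c' \o b).
  by apply/matrixP => i j; rewrite !mxE /c' /= bK.
(* Arrival is counted at [None], so a root arrives after one step; the least such [k] serves as
   height in the acyclic case. *)
pose reach k u := iter k (obind c') (Some u) == None.
have reachS k u v : c' u = Some v -> reach k v = reach k.+1 u.
  by move=> cu; rewrite /reach iterSr /= cu.
have [all|/existsNP[u0 Nu0]] := pselect (forall u, exists k, reach k u).
  rewrite det_parent_mx_acyclic //; first exact: can_inj bK.
  exists (fun u => ex_minn (all u)) => u v cu.
  case: ex_minnP => k kv kmin; case: ex_minnP => [[|l]] // lu _.
  by rewrite ltnS kmin // (reachS _ u).
(* The indicator of the vertices leading to a cycle is in the kernel. *)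
suff /eqP -> : \det (parent_mx R b (c' \o b)) == 0 by [].
rewrite -det_tr; apply/det0P.
exists (\row_i (~~ `[< exists k, reach k (b i) >])%:R).
  apply/eqP => /rowP /(_ (g u0)); rewrite !mxE gK.
  by case: asboolP => // _ /eqP; rewrite oner_eq0.
apply/rowP => i; rewrite !mxE.
under eq_bigr do rewrite !mxE mulrBr.
rewrite sumrB (bigD1 i) //= eqxx mulr1 big1 ?addr0 => [|j ji].
  apply/eqP; rewrite subr_eq0; apply/eqP.
  case ci : (c' (b i)) => [v|]; last first.
    rewrite big1 => [|j _]; last by rewrite mulr0.
    by case: asboolP => // -[]; exists 1%N; rewrite /reach /= ci.
  rewrite (bigD1 (g v)) //= gK eqxx mulr1 big1 ?addr0 => [|j].
    congr ((nat_of_bool (~~ _))%:R); apply/asboolP/asboolP => -[k Hk].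
      by case: k Hk => // k; rewrite -(reachS _ _ _ ci) => ?; exists k.
    by exists k.+1; rewrite -(reachS _ _ _ ci).
  move=> jv; case: eqP => [[vj]|_]; last by rewrite mulr0.
  by rewrite vj bK eqxx in jv.
by rewrite eq_sym (negbTE ji) mulr0.
Qed.

(** Each row splits as a sum of differences of unit vectors, one per neighbour, plus a multiple of
    the diagonal unit vector. Picking one summand per row amounts to choosing a parent, or [None]
    for a root. *)
Lemma rooted_forests_le_det (R : realFieldType) (e : rel T) (d m : nat) (x : R)
    (N : nat) (b : 'I_N -> T) :
    bijective b -> 0 < x -> (forall u, (#|[set v | e u v]%SET| <= d)%N) ->
  #|[set c | rooted_forest e m c]%SET|%:R * x ^+ m <=
  \det (\matrix_(i, j) ((d%:R + x) * (i == j)%:R - (e (b i) (b j))%:R)).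
Proof.
move=> bij x0 deg; have [g bK gK] := bij.
pose w (i : 'I_N) (k : option T) : R :=
  if k is Some v then (e (b i) v)%:R else d%:R + x - #|[set v | e (b i) v]%SET|%:R.
pose r (i : 'I_N) (k : option T) (j : 'I_N) : R := (i == j)%:R - (k == Some (b j))%:R.
have -> : \matrix_(i, j) ((d%:R + x) * (i == j)%:R - (e (b i) (b j))%:R) =
    \matrix_(i, j) \sum_k w i k * r i k j.
  apply/matrixP => i j; rewrite !mxE (bigD1 None) //= /r subr0.
  rewrite (reindex_omap Some id) /=; last by case.
  under eq_bigl => v do rewrite eqxx.
  under eq_bigr do rewrite mulrBr.
  rewrite sumrB -mulr_suml.
  have -> : \sum_v (e (b i) v)%:R = #|[set v | e (b i) v]%SET|%:R :> R.
    rewrite -sumr_const [RHS]big_mkcond /=.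
    by apply: eq_bigr => v _; rewrite inE; case: (e _ _).
  rewrite (bigD1 (b j)) //= eqxx mulr1 big1 ?addr0 => [|v vj].
    by rewrite mulrBl addrA subrK.
  by case: eqP => [[/eqP]|]; rewrite ?(negbTE vj) ?mulr0.
rewrite det_sum_rows; pose F (f : {ffun 'I_N -> option T}) :=
  (\prod_i w i (f i)) * \det (\matrix_(i, j) r i (f i) j).
rewrite -/(\sum_f F f).
have w0 i k : 0 <= w i k.
  case: k => [v|] /=; first exact: ler0n.
  by rewrite subr_ge0 (le_trans (y := d%:R)) ?ler_nat // lerDl ltW.
have F0 f : 0 <= F f.
  by rewrite mulr_ge0 ?prodr_ge0 //; exact: (@det_parent_mx_ge0 _ _ b g).
pose phi (c : {ffun T -> option T}) := [ffun i => c (b i)].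
have phiI : injective phi.
  by move=> c1 c2 /ffunP cE; apply/ffunP => u; have := cE (g u); rewrite !ffunE gK.
set G := [set c | _]%SET.
(* All terms are nonnegative, so those that do not come from forests may be dropped. *)
apply: (@le_trans _ _ (\sum_(f in phi @: G) F f)); last first.
  by rewrite big_mkcond ler_sum // => f _; case: ifP.
rewrite big_imset /=; last by move=> ? ? _ _; exact: phiI.
rewrite mulr_natl -sumr_const ler_sum // => c; rewrite inE.
move=> /and3P[/forallP ce /asboolP ac /eqP <-].
rewrite /F.
have -> : \matrix_(i, j) r i (phi c i) j = parent_mx R b (c \o b).
  by apply/matrixP => i j; rewrite !mxE /r ffunE.
rewrite det_parent_mx_acyclic // ?mulr1; last exact: bij_inj.
(* A root weighs at least [x] by the degree bound, and any other vertex weighs 1 because its parent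
   is a neighbour. *)
rewrite -prodr_const big_mkcond /= (reindex b) /=; last exact: onW_bij.
apply: ler_prod => i _; rewrite inE ffunE; case: ifP => [/eqP ->|].
  by rewrite ltW //= addrAC lerDr subr_ge0 ler_nat.
case ci : (c (b i)) => [v|//] _ /=.
by have /forallP/(_ v) := ce (b i); rewrite ci eqxx /= => ->; rewrite ler01 lexx.
Qed.

End Forests.

(** * Forests spanning connected partitions *)

Section ConnectedPartitions.
Context {T : finType} (e : rel T).
Implicit Types P Q : {set {set T}}.

Definition connected_partitions (m : nat) : {set {set {set T}}} :=
  [set P | [&& finset.partition P [set: T]%SET, #|P| == m
             & [forall B in P, connected_in e B]]]%SET.

Definition spans (c : T -> option T) P : Prop :=
  (forall u v, ancestor c u v -> finset.pblock P u = finset.pblock P v) /\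
  (forall u v, finset.pblock P u = finset.pblock P v ->
     exists2 r, ancestor c u r & ancestor c v r).

(** Two vertices of one block of [P] have a common ancestor, and that ancestor lies in the [Q]-block
    of both. So blocks of [P] sit inside blocks of [Q], and the situation is symmetric. *)
Lemma spans_inj c P Q :
    finset.partition P [set: T]%SET -> finset.partition Q [set: T]%SET ->
  spans c P -> spans c Q -> P = Q.
Proof.
wlog suff: P Q / finset.partition P [set: T]%SET ->
    finset.partition Q [set: T]%SET -> spans c P -> spans c Q -> P \subset Q.
  by move=> H pP pQ sP sQ; apply/eqP; rewrite finset.eqEsubset !H.
move=> pP pQ [P1 P2] [Q1 Q2].
have [/eqP covP tP P0] := and3P pP; have [/eqP covQ tQ _] := and3P pQ.
have sub (P' Q' : {set {set T}}) : finset.cover P' = [set: T]%SET ->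
    finset.trivIset P' ->
    finset.cover Q' = [set: T]%SET -> finset.trivIset Q' ->
    (forall u v, ancestor c u v -> finset.pblock Q' u = finset.pblock Q' v) ->
    (forall u v, finset.pblock P' u = finset.pblock P' v ->
      exists2 r, ancestor c u r & ancestor c v r) ->
    forall u, finset.pblock P' u \subset finset.pblock Q' u.
  move=> covP' tP' covQ' tQ' H1 H2 u; apply/fintype.subsetP => v.
  rewrite -!finset.eq_pblock ?covP' ?covQ' ?finset.in_setT // => /eqP /H2 [r ur vr].
  by rewrite (H1 _ _ ur) (H1 _ _ vr).
apply/fintype.subsetP => B BP.
have [x xB] : exists x, x \in B.
  by apply/finset.set0Pn; apply: contraNneq P0 => <-.
rewrite -(finset.def_pblock tP BP xB).
have -> : finset.pblock P x = finset.pblock Q x.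
  by apply/eqP; rewrite finset.eqEsubset !sub.
by rewrite finset.pblock_mem // covQ finset.in_setT.
Qed.

(** Each block gets a root, and every other vertex takes as parent its successor on a shortest path
    to the root inside the block; the distance [h] to the root then drops along parents. *)
Lemma exists_spanning_forest m P : P \in connected_partitions m ->
  exists2 c : {ffun T -> option T}, rooted_forest e m c & spans c P.
Proof.
rewrite inE => /and3P[pP /eqP <- /forallP conP].
have [/eqP covP tP P0] := and3P pP.
have inc u : u \in finset.cover P by rewrite covP finset.in_setT.
have self u : u \in finset.pblock P u by rewrite finset.mem_pblock.
(* The pick depends on the block only; the default is never reached, since the block contains
   [u]. *)
pose rt u := odflt u [pick v in finset.pblock P u].
have rt_in u : rt u \in finset.pblock P u.
  by rewrite /rt; case: pickP => [v //|_] /=.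
have rtP u v : finset.pblock P u = finset.pblock P v -> rt u = rt v.
  by rewrite /rt => <-; case: pickP => // /(_ u); rewrite /= self.
have pb u v : v \in finset.pblock P u -> finset.pblock P v = finset.pblock P u.
  by rewrite -finset.eq_pblock // => /eqP.
have rtK u : rt (rt u) = rt u by apply/rtP/pb.
pose D u k := `[< exists p, [/\ path (Defs.induced e (finset.pblock P u)) u p,
  last u p = rt u & size p = k] >].
have exD u : exists k, D u k.
  have /(_ (finset.pblock P u)) := conP; rewrite finset.pblock_mem //=.
  move=> /forallP/(_ u); rewrite self /= => /forallP/(_ (rt u)).
  rewrite rt_in /= => /connectP[p pp lp].
  by exists (size p); apply/asboolP; exists p.
pose h u := ex_minn (exD u).
have h_rt u : u = rt u -> h u = 0%N.
  move=> ur; rewrite /h; case: ex_minnP => k _ /(_ 0%N).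
  suff D0 : D u 0%N by move=> /(_ D0); rewrite leqn0 => /eqP.
  by apply/asboolP; exists [::].
have step u : exists o : option T, if o is Some v then
    [/\ e u v, finset.pblock P v = finset.pblock P u & (h v < h u)%N] else u = rt u.
  have [ur|ur] := eqVneq u (rt u); first by exists None.
  rewrite {2}/h; case: ex_minnP => k /asboolP[[|v p] [/= pp lp sp] kmin].
    by rewrite -lp eqxx in ur.
  move: pp => /andP[/and3P[_ vB euv] pp]; exists (Some v).
  have vu := pb _ _ vB; split => //; rewrite /h; case: ex_minnP => l _ lmin.
  rewrite -sp ltnS lmin //; apply/asboolP; exists p; split => //.
    by rewrite vu.
  by rewrite lp; apply/esym/rtP.
have [c0 c0P] := choice step; pose c := [ffun u => c0 u].
have cSome u v : c u = Some v ->
    [/\ e u v, finset.pblock P v = finset.pblock P u & (h v < h u)%N].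
  by rewrite ffunE => cu; have := c0P u; rewrite cu.
have cNone u : (c u == None) = (u == rt u).
  apply/eqP/eqP => [|ur].
    by rewrite ffunE => cu; have := c0P u; rewrite cu.
  by case cu : (c u) => [v|//]; have [_ _] := cSome _ _ cu; rewrite (h_rt _ ur).
have anc_rt u : ancestor c u (rt u).
  have [k hk] := ubnP (h u); elim: k u hk => // k IHk u hk.
  case cu : (c u) => [v|]; last first.
    by move/eqP: cu; rewrite cNone => /eqP <-; exact: connect0.
  have [_ vu hv] := cSome _ _ cu; rewrite -(rtP _ _ vu).
  apply: connect_trans (IHk _ (leq_trans hv hk)).
  by apply: connect1; rewrite cu.
exists c; last split => [u v /connectP[p pp ->]|u v uv].
- apply/and3P; split.
  + by apply/forallP => u; apply/forallP => v; apply/implyP => /eqP /cSome[].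
  + by apply/asboolP; exists h => u v /cSome[].
  (* Every block contains exactly one root, so [pblock] maps the roots bijectively onto [P]. *)
  + rewrite -(card_in_imset (f := finset.pblock P)) => [|u v].
      apply/eqP; congr #|pred_of_set _|; apply/finset.setP => B.
      apply/finset.imsetP/idP => [[u _ ->]|BP]; first by rewrite finset.pblock_mem.
      have [x xB] : exists x, x \in B.
        by apply/finset.set0Pn; apply: contraNneq P0 => <-.
      exists (rt x); first by rewrite inE cNone rtK.
      by rewrite (pb _ _ (rt_in x)) (finset.def_pblock tP BP xB).
    by rewrite !inE !cNone => /eqP -> /eqP ->; move=> /rtP; rewrite !rtK.
- by elim: p u pp => //= w p IHp u /andP[/eqP /cSome[_ <- _] /IHp].
- by exists (rt u) => //; rewrite (rtP _ _ uv).
Qed.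

Lemma card_connected_partitions_le m :
  (#|connected_partitions m| <= #|[set c | rooted_forest e m c]%SET|)%N.
Proof.
have forestP P : exists c : {ffun T -> option T},
    P \in connected_partitions m -> rooted_forest e m c /\ spans c P.
  have [Pm|] := boolP (P \in connected_partitions m); last by exists [ffun=> None].
  by have [c ? ?] := exists_spanning_forest _ _ Pm; exists c.
have [c cP] := choice forestP.
rewrite -(card_in_imset (f := c)) => [|P Q Pm Qm cPQ].
  apply/subset_leq_card/fintype.subsetP => _ /finset.imsetP[P /cP[? _] ->].
  by rewrite inE.
have [_ sP] := cP _ Pm; have [_ sQ] := cP _ Qm; rewrite -cPQ in sQ.
by move: Pm Qm; rewrite !inE => /and3P[? _ _] /and3P[? _ _]; exact: (spans_inj (c P)).
Qed.

End ConnectedPartitions.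

Lemma card_tilings_le (n : nat) :
  (#|tilings n| <= #|[set c | rooted_forest (@grid_adj n) n c]%SET|)%N.
Proof.
apply: leq_trans (card_connected_partitions_le (@grid_adj n) n).
apply/subset_leq_card/fintype.subsetP => P; rewrite !inE => /and3P[-> -> /forallP PB].
by apply/forallP => B; apply/implyP => BP; have := PB B; rewrite BP /= => /andP[].
Qed.

Lemma grid_degree_le4 (n : nat) (u : cell n) :
  (#|[set v | grid_adj u v]%SET| <= 4)%N.
Proof.
(* A neighbour is determined by two bits: which coordinate differs, and in which direction. *)
pose k (v : cell n) : bool * bool :=
  (u.1 == v.1, (v.1 < u.1)%N || (v.2 < u.2)%N).
have -> : 4%N = #|{: bool * bool}| by rewrite card_prod card_bool.
rewrite -(card_in_imset (f := k)); first exact: max_card.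
move: u @k => [u1 u2] k [v1 v2] [w1 w2].
rewrite !inE /grid_adj /succ_or_pred /k /= -!val_eqE /= => uv uw [E1 E2].
by congr pair; apply/val_inj => /=; lia.
Qed.

(** * The determinant of the grid *)

(* Chebyshev polynomials of the second kind, rescaled to be monic. *)
Fixpoint cheb (R : nzRingType) (k : nat) : {poly R} :=
  match k with
  | 0 => 1
  | 1 => 'X
  | (k'.+1 as k1).+1 => 'X * cheb R k1 - cheb R k'
  end.

Lemma chebSS (R : nzRingType) k : cheb R k.+2 = 'X * cheb R k.+1 - cheb R k.
Proof. by []. Qed.

Section Chebyshev.
Variable R : realType.
Local Notation cheb := (cheb R).

Lemma cheb_monic_size k : (cheb k \is monic) /\ size (cheb k) = k.+1.
Proof.
suff: ((cheb k \is monic) /\ size (cheb k) = k.+1) /\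
  ((cheb k.+1 \is monic) /\ size (cheb k.+1) = k.+2) by case.
elim: k => [|k [[mk sk] [mk1 sk1]]].
  by rewrite monic1 size_poly1 monicX size_polyX.
split=> //; rewrite chebSS.
have sX : size ('X * cheb k.+1) = k.+3.
  by rewrite mulrC size_mulX ?sk1 // monic_neq0.
have lt_s : (size (- cheb k) < size ('X * cheb k.+1)%R)%N.
  by rewrite size_polyN sk sX.
split; last by rewrite size_polyDl.
by rewrite monicE lead_coefDl // -monicE monicMl // monicX.
Qed.

Lemma cheb_sin k (phi : R) :
  (cheb k).[2 * cos phi] * sin phi = sin (k.+1%:R * phi).
Proof.
suff: (cheb k).[2 * cos phi] * sin phi = sin (k.+1%:R * phi) /\
  (cheb k.+1).[2 * cos phi] * sin phi = sin (k.+2%:R * phi) by case.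
elim: k => [|k [IH0 IH1]].
  rewrite hornerC hornerX !mul1r; split=> //.
  by rewrite [in RHS]mulr_natl mulr2n sinD; ring.
split=> //; rewrite chebSS hornerD hornerN mulrC hornerM hornerX mulrC.
rewrite mulrBl IH0 -mulrA IH1.
have -> : k.+3%:R * phi = k.+2%:R * phi + phi by rewrite -[in LHS]natr1; ring.
have -> : k.+1%:R * phi = k.+2%:R * phi - phi by rewrite -[in RHS]natr1; ring.
by rewrite !sinD sinN cosN; ring.
Qed.

Definition angle n (i : 'I_n) : R := pi * i.+1%:R / n.+1%:R.

(** These are the roots of [cheb n] and also the eigenvalues of the path on [n] vertices. *)
Definition node n (i : 'I_n) : R := 2 * cos (angle n i).

Lemma angle_itv n i : 0 < angle n i < pi.
Proof.
rewrite /angle divr_gt0 ?mulr_gt0 ?pi_gt0 ?ltr0n //=.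
by rewrite ltr_pdivrMr ?ltr0n // ltr_pM2l ?pi_gt0 // ltr_nat ltnS.
Qed.

Lemma node_inj n : injective (node n).
Proof.
move=> i j /(mulfI (lt0r_neq0 (ltr0n _ 2))) eq_cos.
have /andP[i0 ipi] := angle_itv n i; have /andP[j0 jpi] := angle_itv n j.
have : angle n i = angle n j.
  by apply: cos_inj; rewrite ?in_itv /= ?(ltW i0) ?(ltW ipi) ?(ltW j0) ?(ltW jpi).
move=> /(divIf (lt0r_neq0 (ltr0n _ n.+1))) /(mulfI (lt0r_neq0 (pi_gt0 R))) /eqP.
by rewrite eqr_nat eqSS => /eqP/val_inj.
Qed.

Lemma cheb_node n i : (cheb n).[node n i] = 0.
Proof.
have /andP[i0 ipi] := angle_itv n i.
have s0 : sin (angle n i) != 0 by rewrite gt_eqF // sin_gt0_pi // i0 ipi.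
apply: (mulIf s0); rewrite mul0r cheb_sin /angle mulrCA mulfV ?pnatr_eq0 // mulr1.
rewrite mulr_natr; elim: {i i0 ipi s0}i.+1 => [|k IHk]; first by rewrite sin0.
by rewrite mulrS sinD sinpi IHk mul0r mulr0 addr0.
Qed.

Lemma cheb_prod n : cheb n = \prod_(i < n) ('X - (node n i)%:P).
Proof.
have [mn sn] := cheb_monic_size n.
rewrite [LHS](all_roots_prod_XsubC (rs := [seq node n i | i <- enum 'I_n])).
- by rewrite (monicP mn) scale1r big_map big_enum.
- by rewrite sn size_map size_enum_ord.
- by apply/allP => _ /mapP[i _ ->]; apply/rootP/cheb_node.
- by rewrite uniq_rootsE map_inj_uniq ?enum_uniq //; exact: node_inj.
Qed.

Lemma horner_cheb n (y : R) : (cheb n).[y] = \prod_(i < n) (y - node n i).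
Proof.
by rewrite cheb_prod horner_prod; apply: eq_bigr => i _; rewrite hornerXsubC.
Qed.

(** All roots are at most 2, so the product form increases beyond 2 and [y] may be replaced by
    [z + z^-1]. There the value is the sum of z^(n-2j) over 0 <= j <= n, with [n + 1] terms of size
    at most [z ^+ n]. *)
Lemma cheb_le n (y z : R) : 1 <= z -> 2 <= y <= z + z^-1 ->
  0 <= (cheb n).[y] <= n.+1%:R * z ^+ n.
Proof.
move=> z1 /andP[y2 yz]; have z0 : 0 < z by rewrite (lt_le_trans _ z1).
have node2 i : 0 <= y - node n i.
  by rewrite subr_ge0 (le_trans _ y2) // -[leRHS]mulr1 ler_pM2l ?ltr0n // cos_le1.
rewrite horner_cheb prodr_ge0 //=.
apply: (@le_trans _ _ (cheb n).[z + z^-1]).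
  by rewrite horner_cheb ler_prod // => i _; rewrite node2 lerB.
have rec k : (cheb k.+1).[z + z^-1] = z * (cheb k).[z + z^-1] + z^-1 ^+ k.+1.
  elim: k => [|k IHk]; first by rewrite hornerC hornerX mulr1 expr1.
  rewrite chebSS hornerD hornerN mulrC hornerM hornerX IHk [z^-1 ^+ k.+2]exprS.
  by field; rewrite gt_eqF.
elim: n {node2} => [|n IHn]; first by rewrite hornerC expr0 mulr1.
rewrite rec -[n.+2%:R]natr1 mulrDl mul1r lerD //.
  by rewrite exprS mulrCA ler_pM2l.
rewrite (@le_trans _ _ 1) // ?exprn_ege1 //.
by rewrite exprn_ile1 ?invr_ge0 ?(ltW z0) ?invf_le1.
Qed.

(** * Diagonalisation of the path and of the grid *)

Definition path_mx n : 'M[R]_n := \matrix_(i, j) (succ_or_pred i j)%:R.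

Definition cheb_mx n : 'M[R]_n := \matrix_(i, k) (cheb k).[node n i].

(** The matrix is a Vandermonde matrix at distinct nodes times the coefficient matrix of monic
    polynomials of degrees 0, ..., n - 1, which is unitriangular. *)
Lemma cheb_mx_unit n : cheb_mx n \in unitmx.
Proof.
pose C : 'M[R]_n := \matrix_(j, k) (cheb k)`_j.
have -> : cheb_mx n = (Vandermonde n (\row_i node n i))^T *m C.
  apply/matrixP => i k; rewrite !mxE (horner_coef_wide (n := n)); last first.
    by have [_ ->] := cheb_monic_size k.
  by apply: eq_bigr => j _; rewrite !mxE mulrC.
rewrite unitmx_mul unitmx_tr !unitmxE !unitfE det_Vandermonde.
apply/andP; split.
  apply/prodf_neq0 => i _; apply/prodf_neq0 => j ij; rewrite !mxE subr_eq0.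
  by rewrite (inj_eq (@node_inj n)) gt_eqF.
rewrite -det_tr det_trig.
  apply/prodf_neq0 => i _; rewrite !mxE.
  have [m s] := cheb_monic_size i.
  by have := monicP m; rewrite lead_coefE s /= => ->; rewrite oner_eq0.
apply/is_trig_mxP => i j ij; rewrite !mxE nth_default //.
by have [_ ->] := cheb_monic_size i.
Qed.

Lemma sum_ord_delta n (F : nat -> R) a :
  \sum_(j < n) F j * (nat_of_ord j == a)%:R = if (a < n)%N then F a else 0.
Proof.
case: ltnP => an; last first.
  by rewrite big1 // => j _; rewrite ltn_eqF ?mulr0 // (leq_trans _ an).
rewrite (bigD1 (Ordinal an)) //= eqxx mulr1 big1 ?addr0 // => j.
by rewrite -val_eqE /= => /negbTE ->; rewrite mulr0.
Qed.

(** The three-term recursion is the eigenvector equation of the path. At the far end the missing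
    neighbour would contribute the value of [cheb n] at a root, which is 0. *)
Lemma cheb_mx_path n :
  cheb_mx n *m path_mx n = diag_mx (\row_i node n i) *m cheb_mx n.
Proof.
apply/matrixP => i k; rewrite mul_diag_mx !mxE.
pose F j := (cheb j).[node n i].
transitivity ((if (0 < k)%N then F k.-1 else 0) + F k.+1); last first.
  case: k => -[|k] kn /=.
    by rewrite add0r /F hornerX hornerC mulr1.
  by rewrite /F chebSS hornerD hornerN mulrC hornerM hornerX; ring.
transitivity (\sum_(j < n) (F j * ((0 < k)%N && (nat_of_ord j == k.-1))%:R +
    F j * (nat_of_ord j == k.+1)%:R)).
  apply: eq_bigr => j _; rewrite !mxE -/(F j) -mulrDr; congr (_ * _).
  rewrite -natrD; congr (_%:R); rewrite /succ_or_pred.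
  by case: k => -[|k] kn /=; lia.
rewrite big_split; congr (_ + _); last first.
  rewrite /= sum_ord_delta; case: ltnP => // nk.
  have -> : k.+1 = n by apply/eqP; rewrite eqn_leq ltn_ord nk.
  by rewrite /F cheb_node.
case: ltnP => k0; last by rewrite big1 // => j _; rewrite mulr0.
by rewrite /= sum_ord_delta (leq_ltn_trans (leq_pred k)).
Qed.

Definition grid_mx n (y : R) : 'M[R]_(n * n) :=
  \matrix_(i, j) (y * (i == j)%:R -
    (grid_adj (mxtens_unindex i) (mxtens_unindex j))%:R).

(** The grid is the Cartesian product of two paths. *)
Lemma grid_mxE n y :
  grid_mx n y = y%:M - path_mx n *t 1%:M - 1%:M *t path_mx n.
Proof.
apply/matrixP => i j; case: (mxtens_indexP i) => i1 i2.
case: (mxtens_indexP j) => j1 j2.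
rewrite !mxE !mxtens_indexK /= /grid_adj /= (can_eq (@mxtens_indexK n n)) xpair_eqE.
rewrite mulr_natr -!addrA -!opprD; congr (_ - _).
rewrite -!natrM -natrD addnC; congr (_%:R).
by rewrite -!val_eqE /= /succ_or_pred; lia.
Qed.

(** The tensor square of [cheb_mx n] diagonalises the grid, with eigenvalues
    [y - node n i - node n j]; the product over [j] is a value of [cheb n]. *)
Lemma det_grid_mx n (y : R) : (0 < n)%N ->
  \det (grid_mx n y) = \prod_(i < n) (cheb n).[y - node n i].
Proof.
move=> n0.
pose V := cheb_mx n *t cheb_mx n.
pose D : 'rV[R]_(n * n) :=
  \row_k (y - node n (mxtens_unindex k).1 - node n (mxtens_unindex k).2).
have DE : diag_mx D = y%:M - diag_mx (\row_i node n i) *t 1%:M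
    - 1%:M *t diag_mx (\row_i node n i).
  apply/matrixP => i j; case: (mxtens_indexP i) => i1 i2.
  case: (mxtens_indexP j) => j1 j2.
  rewrite !mxE !mxtens_indexK /= (can_eq (@mxtens_indexK n n)) xpair_eqE.
  by case: (i1 == j1); case: (i2 == j2); rewrite /= ?mulr1n ?mulr0n; ring.
have VD : V *m grid_mx n y = diag_mx D *m V.
  rewrite grid_mxE DE !mulmxBr !mulmxBl /V !tensmx_mul !mulmx1 !mul1mx.
  by rewrite !cheb_mx_path mul_mx_scalar mul_scalar_mx.
have Vu : V \in unitmx by rewrite tensmx_unit ?cheb_mx_unit // -lt0n.
have dV : \det V != 0 by rewrite -unitfE -unitmxE.
apply: (mulfI dV); rewrite -det_mulmx VD det_mulmx mulrC; congr (_ * _).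
rewrite det_diag (reindex (@mxtens_index n n)) /=; last first.
  by exists (@mxtens_unindex n n) => k _; rewrite ?mxtens_indexK ?mxtens_unindexK.
under [RHS]eq_bigr do rewrite horner_cheb.
rewrite pair_bigA /=; apply: eq_bigr => -[i j] _.
by rewrite mxE mxtens_indexK.
Qed.

End Chebyshev.

(** * Taylor polynomials of arcsinh *)

Section Arcsinh.
Variable R : realType.
Implicit Types (t s x : R) (k K n : nat).

Definition sinh t : R := (expR t - expR (- t)) / 2.
Definition cosh t : R := (expR t + expR (- t)) / 2.

Lemma is_derive_continuous (f df : R -> R) :
  (forall t, is_derive t 1 f (df t)) -> continuous f.
Proof.
by move=> fdf t; apply/differentiable_continuous/derivable1_diffP; case: (fdf t).
Qed.

Lemma is_derive_nondecreasing (f df : R -> R) (a b : R) :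
    (forall t, is_derive t 1 f (df t)) -> a <= b ->
  (forall t, a <= t <= b -> 0 <= df t) -> f a <= f b.
Proof.
move=> fdf ab df0.
have cf : {within `[a, b], continuous f}%classic.
  by apply: continuous_subspaceT; exact: is_derive_continuous fdf.
have [c] := MVT_segment ab (fun x _ => fdf x) cf.
rewrite in_itv /= => /df0 dfc E.
by rewrite -subr_ge0 E mulr_ge0 // subr_ge0.
Qed.

Lemma is_derive_exp_fun (f : R -> R) n t (df : R) : is_derive t 1 f df ->
  is_derive t 1 (fun s => f s ^+ n) (n%:R * f t ^+ n.-1 * df).
Proof.
move=> fdf; have := is_deriveX n fdf.
have -> // : f ^+ n = fun s => f s ^+ n.
by apply/funext => s; rewrite exprfctE.
Qed.

Lemma is_derive_expRN t : is_derive t 1 (fun s => expR (- s)) (- expR (- t)).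
Proof.
have := is_derive1_comp (is_derive_expR (- t)) (is_deriveNid t (1 : R)).
by rewrite mulrN1.
Qed.

Lemma is_derive_sinh t : is_derive t 1 sinh (cosh t).
Proof.
have := is_deriveZ 2^-1 (is_deriveB (is_derive_expR t) (is_derive_expRN t)).
rewrite opprK /cosh mulrC; congr is_derive.
by apply/funext => s; rewrite /sinh mulrC.
Qed.

Lemma is_derive_cosh t : is_derive t 1 cosh (sinh t).
Proof.
have := is_deriveZ 2^-1 (is_deriveD (is_derive_expR t) (is_derive_expRN t)).
rewrite /sinh mulrC; congr is_derive.
by apply/funext => s; rewrite /cosh mulrC.
Qed.

Lemma cosh_ge1 t : 1 <= cosh t.
Proof.
rewrite /cosh expRN; have := expR_gt0 t; set a := expR t => a0.
have : 0 <= (a - 1) ^+ 2 / a by rewrite divr_ge0 ?sqr_ge0 ?ltW.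
have -> : (a - 1) ^+ 2 / a = a + a^-1 - 2 by field; rewrite gt_eqF.
lra.
Qed.

Lemma cosh2 t : cosh t ^+ 2 = 1 + sinh t ^+ 2.
Proof. by rewrite /cosh /sinh expRN; field; rewrite gt_eqF ?expR_gt0. Qed.

Lemma sinhD s t : sinh (s + t) = sinh s * cosh t + cosh s * sinh t.
Proof.
by rewrite /sinh /cosh opprD !expRD !expRN; field; rewrite !gt_eqF ?expR_gt0.
Qed.

Lemma sinh0 : sinh 0 = 0.
Proof. by rewrite /sinh oppr0 subrr mul0r. Qed.

Lemma cosh0 : cosh 0 = 1.
Proof. by rewrite /cosh oppr0 expR0 -mulr2n divff ?pnatr_eq0. Qed.

Lemma sinh_le s t : s <= t -> sinh s <= sinh t.
Proof.
move=> st; apply: (is_derive_nondecreasing sinh cosh) => // [|u _].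
  exact: is_derive_sinh.
by rewrite (le_trans ler01) ?cosh_ge1.
Qed.

Lemma sinh_ge0 t : 0 <= t -> 0 <= sinh t.
Proof. by move=> t0; rewrite -sinh0 sinh_le. Qed.

Lemma sinh_gt0 t : 0 < t -> 0 < sinh t.
Proof.
move=> t0; rewrite /sinh divr_gt0 ?ltr0n // subr_gt0 ltr_expR.
by rewrite (lt_trans _ t0) // oppr_lt0.
Qed.

Lemma sinh_surj s : 0 <= s -> exists2 t, 0 <= t & sinh t = s.
Proof.
move=> s0; pose r := Num.sqrt (s ^+ 2 + 1).
have r2 : r ^+ 2 = s ^+ 2 + 1 by rewrite sqr_sqrtr // addr_ge0 ?sqr_ge0.
have r1 : 1 <= r by rewrite -[leLHS]sqrtr1 ler_wsqrtr // lerDr sqr_ge0.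
have rs : 0 < s + r by lra.
exists (ln (s + r)); first by rewrite ln_ge0 //; lra.
rewrite /sinh expRN lnK ?posrE //.
have -> : (s + r)^-1 = r - s.
  apply: (mulfI (lt0r_neq0 rs)); rewrite mulfV ?gt_eqF //.
  have -> : (s + r) * (r - s) = r ^+ 2 - s ^+ 2 by ring.
  by rewrite r2; ring.
by field.
Qed.

(* The coefficient 'C(2k, k) / 4^k of the binomial series of (1 - y)^(-1/2). *)
Definition bcoef k : R := \prod_(j < k) ((2 * j + 1)%:R / (2 * j + 2)%:R).

Lemma bcoefS k : bcoef k.+1 = bcoef k * ((2 * k + 1)%:R / (2 * k + 2)%:R).
Proof. by rewrite /bcoef big_ord_recr. Qed.

Lemma bcoef_ge0 k : 0 <= bcoef k.
Proof. by apply: prodr_ge0 => j _; rewrite divr_ge0. Qed.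

Definition asinh_poly K s : R :=
  \sum_(k < K.+1) (-1) ^+ k * (bcoef k / (2 * k + 1)%:R) * s ^+ (2 * k + 1).

(** The derivative of [asinh_poly K (sinh t)]: substituting s = sinh t turns the comparison with
    arcsinh s into one with [t]. *)
Definition dasinh_poly K t : R :=
  \sum_(k < K.+1) (-1) ^+ k * bcoef k * sinh t ^+ (2 * k) * cosh t.

(** The sum telescopes: after replacing cosh^2 by 1 + sinh^2, the recursion [bcoefS] cancels
    everything but the last term. *)
Lemma is_derive_dasinh_poly K t :
  is_derive t 1 (dasinh_poly K)
    ((-1) ^+ K * (2 * K + 1)%:R * bcoef K * sinh t ^+ (2 * K + 1)).
Proof.
pose f k s := (-1) ^+ k * bcoef k * sinh s ^+ (2 * k) * cosh s.
have df k : is_derive t 1 (f k) ((-1) ^+ k * bcoef k *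
    ((2 * k)%:R * sinh t ^+ (2 * k).-1 * cosh t ^+ 2 + sinh t ^+ (2 * k + 1))).
  have := is_deriveZ ((-1) ^+ k * bcoef k) (is_deriveM
    (is_derive_exp_fun _ (2 * k) _ _ (is_derive_sinh t)) (is_derive_cosh t)).
  rewrite (_ : _ \*: _ = f k); last by apply/funext => s; rewrite /f -mulrA.
  move=> H; apply: is_derive_eq H _.
  by rewrite /GRing.scale /= addn1 [_ ^+ (2 * k).+1]exprS; ring.
elim: K => [|K IHK].
  have := df 0%N; rewrite (_ : f 0%N = dasinh_poly 0); last first.
    by apply/funext => s; rewrite /dasinh_poly big_ord1.
  move=> H; apply: is_derive_eq H _.
  by rewrite muln0; ring.
have := is_deriveD IHK (df K.+1).
rewrite (_ : _ + f K.+1 = dasinh_poly K.+1); last first.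
  by apply/funext => s; rewrite /dasinh_poly [RHS]big_ord_recr.
move=> H; apply: is_derive_eq H _; rewrite cosh2 bcoefS.
have -> : (2 * K.+1).-1 = (2 * K + 1)%N by lia.
have -> : (2 * K.+1 + 1 = (2 * K + 1) + 2)%N by lia.
have -> : (2 * K.+1 = 2 * K + 2)%N by lia.
rewrite exprS [_ ^+ (_ + _ + 2)]exprD; field.
by rewrite -natrM -natrD pnatr_eq0 addn2.
Qed.

Lemma is_derive_asinh_poly K t :
  is_derive t 1 (asinh_poly K \o sinh) (dasinh_poly K t).
Proof.
have df k : is_derive t 1
    (fun s => (-1) ^+ k * (bcoef k / (2 * k + 1)%:R) * sinh s ^+ (2 * k + 1))
    ((-1) ^+ k * bcoef k * sinh t ^+ (2 * k) * cosh t).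
  have := is_deriveZ ((-1) ^+ k * (bcoef k / (2 * k + 1)%:R))
    (is_derive_exp_fun _ (2 * k + 1) _ _ (is_derive_sinh t)).
  move=> H; apply: is_derive_eq H _.
  rewrite /GRing.scale /= addn1 /=; field.
  by rewrite -natrM nat1r pnatr_eq0.
elim: K => [|K IHK].
  rewrite (_ : _ \o _ = fun s =>
    (-1) ^+ 0 * (bcoef 0 / (2 * 0 + 1)%:R) * sinh s ^+ (2 * 0 + 1)).
    by move: (df 0%N); rewrite /dasinh_poly big_ord1.
  by apply/funext => s; rewrite /asinh_poly /= big_ord1.
have := is_deriveD IHK (df K.+1).
rewrite (_ : _ + _ = asinh_poly K.+1 \o sinh); last first.
  by apply/funext => s; rewrite /asinh_poly /= [RHS]big_ord_recr.
by rewrite /dasinh_poly [in X in _ -> X]big_ord_recr.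
Qed.

Lemma dasinh_poly_ge1 K t : ~~ odd K -> 0 <= t -> 1 <= dasinh_poly K t.
Proof.
move=> oK t0; have <- : dasinh_poly K 0 = 1.
  rewrite /dasinh_poly big_ord_recl big1 => [|k _].
    by rewrite /bcoef big_ord0 cosh0 muln0 expr0 !mulr1 addr0.
  by rewrite sinh0 expr0n /= mulr0 mul0r.
apply: is_derive_nondecreasing (is_derive_dasinh_poly K) t0 _ => s /andP[s0 _].
by rewrite -signr_odd (negbTE oK) mul1r !mulr_ge0 ?exprn_ge0 ?bcoef_ge0 ?sinh_ge0.
Qed.

(** With s = sinh t, both [asinh_poly K (sinh t)] and [t] vanish at 0, and the former has derivative
    at least 1. Even [K] gives the uncancelled last term its positive sign. *)
Lemma sinh_asinh_poly K s : ~~ odd K -> 0 <= s ->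
  0 <= asinh_poly K s /\ s <= sinh (asinh_poly K s).
Proof.
move=> oK /sinh_surj[t t0 <-].
suff le_t : t <= asinh_poly K (sinh t) by split; [exact: le_trans le_t|exact: sinh_le].
rewrite -subr_ge0.
have {1}<- : asinh_poly K (sinh 0) - 0 = 0.
  rewrite subr0 sinh0 /asinh_poly big1 // => k _.
  by rewrite expr0n addn1 /= mulr0.
have dd u := is_deriveB (is_derive_asinh_poly K u) (is_derive_id u (1 : R)).
apply: (is_derive_nondecreasing _ _ _ _ dd t0) => u /andP[u0 _].
by rewrite subr_ge0 dasinh_poly_ge1.
Qed.

End Arcsinh.

(** * Riemann sums of powers of the sine *)

Section RiemannSums.
Variable R : realType.
Implicit Types (t u x : R) (k K n : nat).

(** On each cell the mean value theorem writes the increment of [F] as [h * f c], and monotonicity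
    bounds [f c] by the values at the ends. *)
Lemma riemann_sum_bounds (F f : R -> R) (h b : R) n :
    (forall t, is_derive t 1 F (f t)) -> 0 <= h -> n%:R * h <= b ->
    (forall s t, 0 <= s -> s <= t -> t <= b -> f s <= f t) ->
  \sum_(i < n) h * f (i%:R * h) <= F (n%:R * h) - F 0
    <= \sum_(i < n) h * f (i.+1%:R * h).
Proof.
move=> dF h0 nb fle; elim: n nb => [|n IHn] nb.
  by rewrite !big_ord0 mul0r subrr lexx.
have nh : n%:R * h <= n.+1%:R * h by rewrite ler_wpM2r // ler_nat.
have /andP[IH1 IH2] := IHn (le_trans nh nb).
have cF : {within `[n%:R * h, n.+1%:R * h], continuous F}%classic.
  by apply: continuous_subspaceT; exact: is_derive_continuous dF.
have [c] := MVT_segment nh (fun x _ => dF x) cF.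
rewrite in_itv /= => /andP[c1 c2].
have -> : n.+1%:R * h - n%:R * h = h by rewrite -natr1; ring.
move=> E; rewrite !big_ord_recr /=.
have -> : F (n.+1%:R * h) - F 0 = F (n%:R * h) - F 0 + h * f c.
  by rewrite [h * _]mulrC -E; ring.
have n0 : 0 <= n%:R * h by rewrite mulr_ge0.
rewrite !lerD // ler_wpM2l // fle // ?(le_trans n0) //.
by rewrite (le_trans c2).
Qed.

(* An antiderivative of sin ^ (2k + 1), by Wallis' recursion. *)
Fixpoint sin_prim k (u : R) : R :=
  if k is k'.+1 then
    (2 * k + 1)%:R^-1 * ((2 * k)%:R * sin_prim k' u - cos u * sin u ^+ (2 * k))
  else - cos u.

Lemma is_derive_sin_prim k u :
  is_derive u 1 (sin_prim k) (sin u ^+ (2 * k + 1)).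
Proof.
elim: k => [|k IHk].
  have := is_deriveN (is_derive_cos u); rewrite opprK.
  by rewrite expr1.
have := is_deriveZ (2 * k.+1 + 1)%:R^-1 (is_deriveB (is_deriveZ (2 * k.+1)%:R IHk)
  (is_deriveM (is_derive_cos u)
    (is_derive_exp_fun _ _ (2 * k.+1) _ _ (is_derive_sin u)))).
move=> H; apply: is_derive_eq H _.
have -> : (2 * k.+1).-1 = (2 * k + 1)%N by lia.
have -> : (2 * k.+1 + 1 = (2 * k + 1) + 2)%N by lia.
have -> : (2 * k.+1 = (2 * k + 1) + 1)%N by lia.
have : (2 * k + 1 + 2)%:R != 0 :> R by rewrite pnatr_eq0 addnS.
rewrite !(exprD _ (2 * k + 1)) !(natrD _ (2 * k + 1)) expr1 /GRing.scale /=.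
move: (sin u ^+ (2 * k + 1)) (2 * k + 1)%:R => p m m0.
have -> : cos u * ((m + 1) * p * cos u) = (m + 1) * p * (1 - sin u ^+ 2).
  by rewrite -cos2sin2; ring.
by field.
Qed.

(** Wallis' recursion is inverse to [bcoefS] up to the factor (2k+1)/(2k+3). Hence the arcsinh
    coefficient, times the Wallis integral, is a term of Catalan's series. *)
Lemma sin_prim_pihalf k :
  bcoef R k * (sin_prim k (pi / 2) - sin_prim k 0) = (2 * k + 1)%:R^-1.
Proof.
elim: k => [|k IHk] /=.
  by rewrite /bcoef big_ord0 cos_pihalf cos0 muln0 add0n invr1; ring.
rewrite bcoefS cos_pihalf sin0 expr0n mulr0 mul0r !subr0 -mulrBr -mulrBr.
transitivity ((2 * k + 1)%:R * (2 * k.+1)%:R / (2 * k + 2)%:R / (2 * k.+1 + 1)%:R *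
  (bcoef R k * (sin_prim k (pi / 2) - sin_prim k 0))); first by ring.
rewrite IHk.
have -> : (2 * k.+1 = 2 * k + 2)%N by lia.
field; have := ler0n R k => k0.
by rewrite !gt_eqF //; lra.
Qed.

Lemma sin_le_pihalf s t : 0 <= s -> s <= t -> t <= pi / 2 -> sin s <= sin t.
Proof.
move=> s0 st tpi.
apply: (is_derive_nondecreasing _ _ _ _ _ (@is_derive_sin R)) => // u /andP[su ut].
apply: cos_ge0_pihalf.
by rewrite (le_trans _ (le_trans s0 su)) ?(le_trans ut) // oppr_le0 divr_ge0 // pi_ge0.
Qed.

(** The half angles are the inner points of the subdivision of [0, pi/2] with step [h]. The
    integrand is 0 at the left end and 1 at the right end, so the lower and upper sums differ by
    exactly [h]. *)
Lemma sum_sin_pow n k (h := pi / 2 / n.+1%:R) :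
  `|h * \sum_(i < n) sin (angle R n i / 2) ^+ (2 * k + 1)
     - (sin_prim k (pi / 2) - sin_prim k 0)| <= h.
Proof.
have h0 : 0 <= h by rewrite !divr_ge0 // pi_ge0.
have nh : n.+1%:R * h = pi / 2 by rewrite /h mulrC divfK // pnatr_eq0.
have pi2 : pi / 2 <= pi :> R.
  by rewrite ler_pdivrMr // ler_peMr ?pi_ge0 ?ler1n.
have mono s t : 0 <= s -> s <= t -> t <= pi / 2 ->
    sin s ^+ (2 * k + 1) <= sin t ^+ (2 * k + 1).
  move=> s0 st tpi; rewrite lerXn2r ?nnegrE ?sin_le_pihalf // sin_ge0_pi //.
    by rewrite s0 (le_trans st (le_trans tpi pi2)).
  by rewrite (le_trans s0 st) (le_trans tpi pi2).
have := riemann_sum_bounds _ _ h (pi / 2) n.+1 (is_derive_sin_prim k) h0.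
rewrite nh => /(_ (lexx _) mono).
rewrite big_ord_recl big_ord_recr /= mul0r sin0 expr0n addn1 mulr0 add0r nh.
rewrite sin_pihalf expr1n mulr1.
have -> : \sum_(i < n) h * sin ((lift ord0 i)%:R * h) ^+ (2 * k).+1 =
    h * \sum_(i < n) sin (angle R n i / 2) ^+ (2 * k).+1.
  rewrite mulr_sumr; apply: eq_bigr => i _; congr (_ * sin _ ^+ _).
  by rewrite lift0 /angle /h; field; rewrite nat1r pnatr_eq0.
move=> /andP[H1 H2]; rewrite ler_norml; lra.
Qed.

Definition catalan_term k : R := (-1) ^+ k / ((2 * k + 1)%N%:R ^+ 2).

(** Each power sum is off by at most [h]; after division by [h] the total error does not depend on
    [n]. *)
Lemma sum_asinh_poly n K :
  \sum_(i < n) asinh_poly R K (sin (angle R n i / 2)) <=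
  2 * n.+1%:R / pi * series catalan_term K.+1 +
    \sum_(k < K.+1) bcoef R k / (2 * k + 1)%:R.
Proof.
pose h : R := pi / 2 / n.+1%:R.
have h0 : 0 < h by rewrite !divr_gt0 // pi_gt0.
have hE : 2 * n.+1%:R / pi = h^-1.
  rewrite /h; have := pi_gt0 R; move: (pi : R) => p p0.
  by field; rewrite nat1r pnatr_eq0 /= gt_eqF.
rewrite -(ler_pM2l h0) mulrDr hE mulrA mulfV ?gt_eqF // mul1r.
rewrite /asinh_poly exchange_big /= /series /= big_mkord mulr_sumr.
rewrite mulr_sumr -big_split /=; apply: ler_sum => k _.
rewrite -mulr_sumr; set S := \sum_(i < n) _.
have := sum_sin_pow n k; rewrite -/h -/S; set W := _ - _ => HW.
have -> : catalan_term k = (-1) ^+ k * (bcoef R k / (2 * k + 1)%:R) * W.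
  have := sin_prim_pihalf k; rewrite -/W => E.
  rewrite mulrAC -!mulrA [W * _]mulrA [W * _]mulrC E /catalan_term.
  by rewrite expr2 invfM.
rewrite mulrCA -lerBlDl -mulrBr.
apply: le_trans (ler_norm _) _.
rewrite !normrM normrX normrN1 expr1n mul1r [leRHS]mulrC.
rewrite ger0_norm ?bcoef_ge0 // ger0_norm ?invr_ge0 //.
by rewrite ler_wpM2l // divr_ge0 // bcoef_ge0.
Qed.

End RiemannSums.

(** * Growth of the number of tilings *)

Section TilingBounds.
Variable R : realType.

Lemma card_tilings_le_prod (n : nat) (x : R) (z : 'I_n -> R) :
    (0 < n)%N -> 0 < x -> (forall i, 1 <= z i) ->
    (forall i, 4 + x - node R n i <= z i + (z i)^-1) ->
  #|tilings n|%:R * x ^+ n <= \prod_i (n.+1%:R * z i ^+ n).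
Proof.
move=> n0 x0 z1 zx.
have bij : bijective (@mxtens_unindex n n).
  by exists (@mxtens_index n n); [exact: mxtens_unindexK|exact: mxtens_indexK].
apply: (@le_trans _ _ (\det (grid_mx R n (4 + x)))).
  apply: le_trans (rooted_forests_le_det R (@grid_adj n) 4 n x _ _ bij x0
    (@grid_degree_le4 n)).
  by rewrite ler_wpM2r ?exprn_ge0 ?(ltW x0) // ler_nat card_tilings_le.
rewrite det_grid_mx //; apply: ler_prod => i _; apply: cheb_le => //.
rewrite zx andbT /node; have := cos_le1 (angle R n i); lra.
Qed.

Lemma half_angle (t : R) : cos t = 1 - 2 * sin (t / 2) ^+ 2.
Proof.
have {1}-> : t = t / 2 + t / 2 by field.
rewrite cosD -!expr2 cos2sin2; ring.
Qed.

Lemma card_tilings_le_expR (n K : nat) (e : R) : (0 < n)%N -> ~~ odd K -> 0 < e ->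
  #|tilings n|%:R <= expR (n%:R * (ln n.+1%:R - ln (4 * sinh R e ^+ 2) +
    2 * \sum_(i < n) asinh_poly R K (sin (angle R n i / 2)) + 2 * n%:R * e)).
Proof.
move=> n0 oK e0; pose P i := asinh_poly R K (sin (angle R n i / 2)).
have s0 := sinh_gt0 _ _ e0; set x := 4 * sinh R e ^+ 2.
have x0 : 0 < x by rewrite mulr_gt0 ?exprn_gt0.
have P_ge i : 0 <= P i /\ sin (angle R n i / 2) <= sinh R (P i).
  apply: sinh_asinh_poly => //; have /andP[a0 api] := angle_itv R n i.
  by rewrite sin_ge0_pi //; lra.
pose z i := expR (2 * (P i + e)).
have z1 i : 1 <= z i.
  by have [P0 _] := P_ge i; rewrite -expR0 ler_expR mulr_ge0 // addr_ge0 // ltW.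
have zx i : 4 + x - node R n i <= z i + (z i)^-1.
  have [P0 sP] := P_ge i.
  have -> : z i + (z i)^-1 = 2 + 4 * sinh R (P i + e) ^+ 2.
    rewrite /z mulr_natl mulr2n expRD /sinh expRN; field.
    by rewrite gt_eqF ?expR_gt0.
  rewrite /node half_angle /x.
  have sn0 : 0 <= sin (angle R n i / 2).
    have /andP[a0 api] := angle_itv R n i; rewrite sin_ge0_pi //; lra.
  move: (sin (angle R n i / 2)) sn0 sP => s sn0 sP.
  (* The two sides of the goal are 2 + 4 (s^2 + sinh^2 e) and 2 + 4 sinh^2 (P + e), so
     superadditivity of sinh suffices. *)
  have le_s : s + sinh R e <= sinh R (P i + e).
    rewrite sinhD lerD //.
      by rewrite (le_trans sP) // ler_peMr ?cosh_ge1 // sinh_ge0.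
    by rewrite ler_peMl ?cosh_ge1 // ltW.
  have : (s + sinh R e) ^+ 2 <= sinh R (P i + e) ^+ 2.
    by rewrite lerXn2r ?nnegrE // ?(le_trans _ le_s) // addr_ge0 // ltW.
  have : 0 <= s * sinh R e by rewrite mulr_ge0 // ltW.
  move: (sinh R e) (sinh R _) => a b; rewrite sqrrD mulr2n; lra.
have := card_tilings_le_prod n x z n0 x0 z1 zx.
rewrite -ler_pdivlMr ?exprn_gt0 // => /le_trans; apply.
rewrite big_split /= prodr_const card_ord prodrXl -expR_sum.
have xE : x ^+ n = expR (n%:R * ln x) by rewrite expRM_natl lnK.
have nE : n.+1%:R ^+ n = expR (n%:R * ln n.+1%:R) :> R.
  by rewrite expRM_natl lnK // posrE ltr0n.
rewrite xE nE -expRM_natl -expRN -!expRD ler_expR -mulr_sumr big_split /=.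
rewrite sumr_const card_ord -mulr_natl.
by rewrite le_eqVlt; apply/orP; left; apply/eqP; ring.
Qed.

(** Absolute convergence, by comparison with the telescoping terms 2/(n+1) - 2/(n+2). *)
Lemma is_cvg_catalan : cvgn (series (catalan_term R)).
Proof.
apply: normed_cvg; apply: nondecreasing_is_cvgn.
  by apply: nondecreasing_series => k _ _; exact: normr_ge0.
exists 2 => _ [n _ <-].
suff: [normed series (catalan_term R)] n <= 2 - 2 / n.+1%:R.
  by move=> /le_trans; apply; rewrite gerBl divr_ge0.
elim: n => [|n IHn].
  by rewrite /= /series /= big_geq // divr1 subrr.
rewrite /= /series /= big_nat_recr //=.
have : `|catalan_term R n| <= 2 / n.+1%:R - 2 / n.+2%:R.
  rewrite /catalan_term normrM normrX normrN1 expr1n mul1r.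
  rewrite ger0_norm ?invr_ge0 ?exprn_ge0 //.
  have -> : 2 / n.+1%:R - 2 / n.+2%:R = (n.+1%:R * n.+2%:R / 2)^-1 :> R.
    by field; rewrite !nat1r -?natrD !pnatr_eq0.
  rewrite lef_pV2 ?posrE ?divr_gt0 ?mulr_gt0 ?exprn_gt0 ?ltr0n ?addn1 //.
  rewrite ler_pdivrMr // -natrX -!natrM ler_nat; nia.
by move=> /(lerD IHn) /le_trans; apply; rewrite addrA subrK.
Qed.

Lemma catalan_series_lt (d : R) : 0 < d ->
  exists2 K, ~~ odd K & series (catalan_term R) K.+1 < catalan R + d.
Proof.
move=> d0; have : catalan R < catalan R + d by rewrite ltrDl.
move=> /(cvgr_lt _ is_cvg_catalan)[N _ HN].
exists N.*2; first by rewrite odd_double.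
by apply: HN => /=; lia.
Qed.

Lemma card_tilings_growth (d : R) : 0 < d -> exists B : R,
  forall n, (0 < n)%N -> #|tilings n|%:R <=
    expR (n%:R ^+ 2 * (4 * catalan R / pi + d) + n%:R * B).
Proof.
move=> d0; have p0 := pi_gt0 R.
(* The slack [d] is split into thirds: truncating Catalan's series, the term [2 * n * e] with e =
   d/6, and ln (n+1). *)
have [K oK ltK] := catalan_series_lt (d * pi / 12) ltac:(by rewrite divr_gt0 ?mulr_gt0).
pose e := d / 6; have e0 : 0 < e by rewrite divr_gt0.
pose S := series (catalan_term R) K.+1.
pose a := \sum_(k < K.+1) bcoef R k / (2 * k + 1)%:R.
have SL : 4 * S / pi <= 4 * catalan R / pi + d / 3.
  rewrite ler_pdivrMr // [leRHS]mulrDl divfK ?gt_eqF //.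
  by move: ltK; rewrite -/S; lra.
exists (d / 3 - ln (d / 3) - ln (4 * sinh R e ^+ 2) + 4 * S / pi + 2 * a) => n n0.
apply: le_trans (card_tilings_le_expR n K e n0 oK e0) _.
rewrite ler_expR [n%:R ^+ 2]expr2 -[n%:R * n%:R * _]mulrA -mulrDr ler_wpM2l //.
(* ln y <= eta y - ln eta absorbs the factor (n+1)^n *)
have lnn : ln n.+1%:R <= d / 3 * n.+1%:R - ln (d / 3).
  have d3 : 0 < d / 3 by rewrite divr_gt0.
  have y0 : 0 < d / 3 * n.+1%:R by rewrite mulr_gt0.
  by have := ltW (ln_sublinear y0); rewrite lnM ?posrE // addrC lerBrDr.
have := sum_asinh_poly R n K; rewrite -/S -/a.
have -> : 2 * n.+1%:R / pi * S = n.+1%:R * (4 * S / pi) / 2.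
  by move: (pi : R) p0 => p p0; field; rewrite gt_eqF.
have n1 : 0 <= n%:R :> R by [].
have : n%:R * (4 * S / pi) <= n%:R * (4 * catalan R / pi + d / 3).
  by rewrite ler_wpM2l.
move: (\sum_(i < n) _) lnn (4 * S / pi) (4 * catalan R / pi) => Z.
rewrite -natr1 /e => lnn s L H1 H2; lra.
Qed.

End TilingBounds.

Local Open Scope classical_set_scope.

Theorem theorem1 (R : realType) :
  exists f : nat -> R,
    (f n @[n --> \oo] --> (0 : R)) /\
    (limn_esup (fun n : nat =>
       (#|tilings n|%:R / (bconst R + f n) ^+ (n ^ 2))%:E) < +oo)%E.
Proof.
pose L : R := 4 * catalan R / pi.
(* The excess of the growth exponent over [L], clipped at 0; the case without tilings avoids the
   default value of [ln] at 0. *)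
pose g n : R := if #|tilings n| == 0%N then 0
  else Num.max 0 (ln #|tilings n|%:R / n%:R ^+ 2 - L).
have g0 n : 0 <= g n by rewrite /g; case: ifP => // _; rewrite le_max lexx.
have cvg_g : g n @[n --> \oo] --> (0 : R).
  apply/cvgrPdist_lt => e e0; have e2 : 0 < e / 2 by rewrite divr_gt0.
  have [B HB] := card_tilings_growth R (e / 2) e2.
  near=> n; rewrite sub0r normrN ger0_norm // /g; case: eqP => // /eqP T0.
  have n0 : (0 < n)%N by near: n; exact: nbhs_infty_gt.
  have n0R : 0 < n%:R :> R by rewrite ltr0n.
  have nB : 2 * B / e < n%:R by near: n; exact: nbhs_infty_gtr.
  rewrite gt_max e0 /= ltrBlDr ltr_pdivrMr ?exprn_gt0 //.
  have T0R : 0 < #|tilings n|%:R :> R by rewrite ltr0n lt0n.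
  have := HB n n0; rewrite -ler_ln ?posrE ?expR_gt0 // expRK -/L => /le_lt_trans; apply.
  have : n%:R * (2 * B) < n%:R * (n%:R * e).
    by rewrite ltr_pM2l // -ltr_pdivrMr.
  lra.
(* With this choice the base is exp (L + g n), whose power n^2 is at least the number of tilings for
   every n > 0; the quotient is then at most 1. *)
exists (fun n => expR (L + g n) - expR L); split.
  rewrite -(subrr (expR L)); apply: cvgB; last exact: cvg_cst.
  apply: continuous_cvg; first exact: continuous_expR.
  by rewrite -[X in _ --> X]addr0; apply: cvgD => //; exact: cvg_cst.
rewrite /limn_esup limf_esupE.
apply: (@le_lt_trans _ _ 1%E); last exact: ltry.
apply: ge_ereal_inf; eexists.
  by exists [set n | (0 < n)%N] => //; exact: nbhs_infty_gt.
apply: ge_ereal_sup => _ [n /= n0 <-]; rewrite lee_fin /bconst -/L addrC subrK.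
rewrite ler_pdivrMr ?exprn_gt0 ?expR_gt0 // mul1r.
have [->|T0] := eqVneq #|tilings n| 0%N; first by rewrite exprn_ge0 ?expR_ge0.
have T0R : 0 < #|tilings n|%:R :> R by rewrite ltr0n lt0n.
rewrite -expRM_natl -[leLHS]lnK ?posrE // ler_expR natrX mulrC.
rewrite -ler_pdivrMr ?exprn_gt0 ?ltr0n //.
by rewrite -lerBlDl /g (negbTE T0) le_max lexx orbT.
Unshelve. all: by end_near. Qed.
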